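(* Let $f:\mathbb{R}\to\mathbb{R}$ be a twice differentiable function (in the sense defined in the context) such that $f(0)\le 0$ and $$f''(-\alpha)+f''(\beta)\ge f''(-\alpha+\gamma)+f''(\beta-\gamma)$$ for any $\alpha>0$, $\beta>0$, $0<\gamma<\alpha+\beta$ such that $f''$ is defined at the points $-\alpha$, $\beta$, $-\alpha+\gamma$ and $\beta-\gamma$. Then, for all independent centered real random variables $\xi$ and $\eta$, $$\mathbf{E} f(\xi)+\mathbf{E} f(\eta)\le \mathbf{E} f(\xi+\eta)$$ whenever the expectations exist.
   Context: A function $f$ on the real line is called twice differentiable if $f'(y)$ exists for all $y$, $f''(y)$ exists for almost all $y$ (with respect to Lebesgue measure), and $f'(b)-f'(a)=\int_a^b f''(y)\,dy$ for all $a<b$. A random variable $\xi$ is centered if $\mathbf{E}|\xi|<\infty$ and $\mathbf{E}\xi=0$. *)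

(* Defs.v *)
From HB Require Import structures.
From mathcomp Require Import all_boot all_order all_algebra.
From mathcomp Require Import all_classical all_reals all_analysis.

Set Implicit Arguments.
Unset Strict Implicit.
Unset Printing Implicit Defensive.

Import Order.TTheory GRing.Theory Num.Theory.
Import numFieldNormedType.Exports.

Local Open Scope ring_scope.
Local Open Scope classical_set_scope.

Definition has_second_derivative (R : realType) (f : R -> R) (y : R) : Prop :=
  derivable (derive1 f) y 1.

Definition second_derivative (R : realType) (f : R -> R) : R -> R :=
  derive1 (derive1 f).

(* Outside [has_second_derivative f] the total function [second_derivative f]
   takes a junk value; by the second clause this concerns a negligible set
   only, so the integrals do not depend on it.  Integrability is stated explicitly because
   the library integral is total. *)
Definition twice_differentiable (R : realType) (f : R -> R) : Prop :=
  [/\ forall y : R, derivable f y 1,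
      {ae (@lebesgue_measure R), forall y : R, has_second_derivative f y} &
      forall a b : R, a < b ->
        (@lebesgue_measure R).-integrable `[a, b]
          (fun y => (second_derivative f y)%:E) /\
        (derive1 f b - derive1 f a)%:E
          = (\int[@lebesgue_measure R]_(y in `[a, b])
               (second_derivative f y)%:E)%E].

Definition centered (d : measure_display) (T : measurableType d)
    (R : realType) (P : probability T R) (X : {RV P >-> R}) : Prop :=
  ('E_P[fun w => `|X w|%R] < +oo)%E /\ 'E_P[X]%E = 0%E.

Definition independent_RV (d : measure_display) (T : measurableType d)
    (R : realType) (P : probability T R) (X Y : {RV P >-> R}) : Prop :=
  forall A B : set R, measurable A -> measurable B ->
    P ((X @^-1` A) `&` (Y @^-1` B)) = (P (X @^-1` A) * P (Y @^-1` B))%E.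

(* The expectation exists in [-oo, +oo] when the positive and negative parts
   do not both have infinite mean; finite expectations are the case where both
   means are finite. *)
Definition expectation_exists (d : measure_display) (T : measurableType d)
    (R : realType) (P : probability T R) (X : T -> R) : Prop :=
  ('E_P[X^\+] < +oo)%E \/ ('E_P[X^\-] < +oo)%E.

(* Main.v *)
Require Import Defs.
From HB Require Import structures.
From mathcomp Require Import all_boot all_order all_algebra.
From mathcomp Require Import all_classical all_reals all_analysis.
From mathcomp Require Import measurable_realfun ring lra.

(* Write [F x y = f (x + y) - f x - f y + f 0], which is the signed double
   integral of [f'' (u + v)] for [u] from [0] to [x] and [v] from [0] to [y].
   The hypothesis on [f''] says that
     [f'' (u + v) + f'' (u' + v') >= f'' (u + v') + f'' (u' + v)]
   whenever [u' < 0 < u] and [v' < 0 < v].  Integrating this in all four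
   variables gives, for [x' < 0 < x] and [y' < 0 < y],
     [x' y' F x y + x y F x' y' - x' y F x y' - x y' F x' y >= 0].
   Integrating once more, [x] and [x'] being independent copies of [xi] and [y],
   [y'] of [eta], and using that the positive and negative parts of a centered
   variable have the same mean, gives [E F(xi, eta) >= 0].  Doing so with the
   positive and negative parts of [F] on opposite sides, all the integrals are
   of nonnegative functions, so the conclusion [E F^- <= E F^+] needs no
   integrability; that of [f(xi)] and [f(eta)] is deduced from it in the only
   case not settled by infinite expectations. *)

Import Order.TTheory GRing.Theory Num.Theory.
Import numFieldNormedType.Exports.

Local Open Scope ring_scope.
Local Open Scope classical_set_scope.

(** * Integration against a centered weight *)

(* Integrate the last hypothesis over [w] with [0 < X w] and [w'] with
   [X w' < 0]: as [X] is centered, both weights have the same integral [m],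
   which cancels unless [X = 0] almost everywhere. *)
Lemma centered_integral_le (d : measure_display) (T : measurableType d)
    (R : realType) (mu : {measure set T -> \bar R}) (X : T -> R)
    (p q : T -> \bar R) :
  measurable_fun [set: T] p -> measurable_fun [set: T] q ->
  (forall w, 0 <= p w)%E -> (forall w, 0 <= q w)%E ->
  mu.-integrable [set: T] (EFin \o X) -> (\int[mu]_w (X w)%:E = 0)%E ->
  (forall w, X w = 0%R -> q w <= p w)%E ->
  (forall w w', (0 < X w)%R -> (X w' < 0)%R ->
    (- X w')%:E * q w + (X w)%:E * q w'
      <= (- X w')%:E * p w + (X w)%:E * p w')%E ->
  (\int[mu]_w q w <= \int[mu]_w p w)%E.
Proof.
move=> mp mq p0 q0 iX X0 le0 le_pn.
have mX : measurable_fun [set: T] X by exact/measurable_EFinP/measurable_int/iX.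
pose A := [set w | 0 < X w]; pose B := [set w | X w < 0].
pose Z := [set w | X w = 0].
have mA : measurable A.
  by rewrite -[A]setTI -[A]/(X @^-1` [set x | 0 < x]) -set_itvoy; exact: mX.
have mB : measurable B.
  by rewrite -[B]setTI -[B]/(X @^-1` [set x | x < 0]) -set_itvNyo; exact: mX.
have mZ : measurable Z.
  by rewrite -[Z]setTI -[Z]/(X @^-1` [set 0]); exact: mX.
have mu2 : measurable (A `|` B) by exact: measurableU.
have AB : [disjoint A & B].
  by apply/disj_setPS => w [/=]; rewrite /A /B /=; lra.
have ABZ : [disjoint A `|` B & Z].
  by apply/disj_setPS => w [/=]; rewrite /A /B /Z /= => -[]; lra.
have ABZT : A `|` B `|` Z = setT.
  apply/seteqP; split=> // w _; rewrite /A /B /Z /=.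
  by case: (ltgtP (X w) 0); [left; right|left; left|right].
have split_int (g : T -> \bar R) : measurable_fun [set: T] g ->
    (forall w, 0 <= g w)%E -> (\int[mu]_w g w =
      \int[mu]_(w in A) g w + \int[mu]_(w in B) g w + \int[mu]_(w in Z) g w)%E.
  move=> mg g0; rewrite -ABZT ge0_integral_setU//; last exact: measurable_funTS.
  by rewrite ge0_integral_setU//; exact: measurable_funTS.
have mDE D (g : T -> \bar R) : measurable_fun [set: T] g -> measurable_fun D g.
  exact: measurable_funTS.
have mX1 : measurable_fun [set: T] (fun w => (X w)%:E) by exact/measurable_EFinP.
have mX2 : measurable_fun [set: T] (fun w => (- X w)%:E).
  by apply/measurable_EFinP; exact: measurableT_comp.
pose m := (\int[mu]_(w in A) (X w)%:E)%E.
have m0 : (0 <= m)%E by apply: integral_ge0 => w; rewrite /A/= lee_fin => /ltW.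
have mfin : m \is a fin_num.
  by apply: integrable_fin_num => //; exact: integrableS iX.
(* Centering makes the integrals of [X] over [A] and over [B] opposite, the one over [Z] being
   zero. *)
have mE : m = (\int[mu]_(w in B) (- X w)%:E)%E.
  have mE0 : (\int[mu]_(w in B) (X w)%:E \is a fin_num)%E.
    by apply: integrable_fin_num => //; exact: integrableS iX.
  have Z0 : (\int[mu]_(w in Z) (X w)%:E = 0)%E.
    by apply: integral0_eq => w /= ->.
  move: X0; rewrite -ABZT integral_setU //=; last by rewrite ABZT.
  rewrite Z0 adde0 integral_setU //=; last exact: mDE.
  rewrite -/m => mB0; transitivity (- \int[mu]_(w in B) (X w)%:E)%E.
    move: mB0; rewrite -(fineK mE0) -(fineK mfin) -EFinD -EFinN => -[mB0].
    by congr EFin; apply/eqP; rewrite -addr_eq0; exact/eqP.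
  rewrite -integralN//; apply: integrable_add_def => //; exact: integrableS iX.
(* If [m = 0], then [A] and [B] are null, since a positive function has integral zero on each; only
   [Z] counts, where the inequality is pointwise. *)
have [m00|mn0] := eqVneq m 0%E.
  have null D : measurable D -> forall h : T -> \bar R,
      (forall w, D w -> 0 < h w)%E -> measurable_fun [set: T] h ->
      (\int[mu]_(w in D) h w = 0)%E -> mu D = 0%E.
    move=> mD h h0 mh hD; have [+ _] := ae_eq_integral_abs mu mD (mDE D h mh).
    have -> : (\int[mu]_(x in D) `|h x| = \int[mu]_(x in D) h x)%E.
      by apply: eq_integral => w; rewrite inE => /h0 /ltW /gee0_abs.
    move=> /(_ hD) [N [mN N0 sN]].
    apply: (subset_measure0 mD mN _ N0) => w Dw; apply: sN => /= /(_ Dw) h00.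
    by have := h0 _ Dw; rewrite h00 ltxx.
  have nA : mu A = 0%E by apply: (null _ _ _ _ mX1) => //.
  have nB : mu B = 0%E.
    apply: (null _ _ _ _ mX2) => //; last by rewrite -mE.
    by move=> w; rewrite /B/= lte_fin; lra.
  rewrite !split_int// !(null_set_integral mA (mDE A _ _) nA)//.
  rewrite !(null_set_integral mB (mDE B _ _) nB)// !add0e.
  by apply: ge0_le_integral => //; exact: mDE.
have mp1 : (0 < m)%E by rewrite lt0e mn0.
(* Integrating the two-point expression over [w] in [A] ([int1]), then over [w'] in [B] ([int2]),
   yields [m] times the integral of [g] over both sets; [m] is finite and positive, so it can be
   cancelled. *)
have int1 (g : T -> \bar R) w' : measurable_fun [set: T] g ->
    (forall w, 0 <= g w)%E -> X w' < 0 ->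
  (\int[mu]_(w in A) ((- X w')%:E * g w + (X w)%:E * g w')
    = (- X w')%:E * \int[mu]_(w in A) g w + m * g w')%E.
  move=> mg g0 Xw'; rewrite ge0_integralD//.
  - rewrite ge0_integralZl//; last 2 first.
    + exact: mDE.
    + by rewrite lee_fin; lra.
    rewrite ge0_integralZr//; first exact: mDE.
    by move=> w; rewrite /A/= lee_fin => /ltW.
  - by move=> w _; apply: mule_ge0 => //; rewrite lee_fin; lra.
  - by apply: mDE; exact: measurable_funeM.
  - by move=> w; rewrite /A/= => /ltW ?; apply: mule_ge0 => //; rewrite lee_fin.
  - by apply: mDE; under eq_fun do rewrite muleC; exact: measurable_funeM.
have int2 (g : T -> \bar R) : measurable_fun [set: T] g ->
    (forall w, 0 <= g w)%E ->
  (\int[mu]_(w' in B) ((- X w')%:E * \int[mu]_(w in A) g w + m * g w')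
    = m * (\int[mu]_(w in A) g w + \int[mu]_(w in B) g w))%E.
  move=> mg g0; have Ag0 : (0 <= \int[mu]_(w in A) g w)%E by exact: integral_ge0.
  rewrite ge0_integralD//.
  - rewrite ge0_integralZl//; last exact: mDE.
    rewrite ge0_integralZr//; last 2 first.
    + exact: mDE.
    + by move=> w; rewrite /B/= lee_fin; lra.
    by rewrite -mE [RHS]ge0_muleDr//; exact: integral_ge0.
  - by move=> w; rewrite /B/= => ?; apply: mule_ge0 => //; rewrite lee_fin; lra.
  - by apply: mDE; under eq_fun do rewrite muleC; exact: measurable_funeM.
  - by move=> w _; exact: mule_ge0.
  - by apply: mDE; exact: measurable_funeM.
rewrite !split_int//; apply: leeD; last first.
  apply: ge0_le_integral => //; exact: mDE.
rewrite -(lee_pmul2l mfin mp1) -!int2//.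
have mi2 (g : T -> \bar R) : measurable_fun [set: T] g ->
    measurable_fun B (fun w' => (- X w')%:E * \int[mu]_(w in A) g w + m * g w')%E.
  move=> mg; apply: mDE; apply: emeasurable_funD; last exact: measurable_funeM.
  by under eq_fun do rewrite muleC; exact: measurable_funeM.
have i20 (g : T -> \bar R) : (forall w, 0 <= g w)%E -> forall w', B w' ->
    (0 <= (- X w')%:E * \int[mu]_(w in A) g w + m * g w')%E.
  move=> g0 w' /= Xw'; apply: adde_ge0; last exact: mule_ge0.
  apply: mule_ge0; last exact: integral_ge0.
  by rewrite lee_fin; move: Xw'; rewrite /B/=; lra.
apply: ge0_le_integral => //; [exact: i20|exact: mi2|exact: mi2|].
move=> w' /= Xw'; rewrite -!int1//.
have mi1 (g : T -> \bar R) : measurable_fun [set: T] g ->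
    measurable_fun A (fun w => (- X w')%:E * g w + (X w)%:E * g w')%E.
  move=> mg; apply: mDE; apply: emeasurable_funD; first exact: measurable_funeM.
  by under eq_fun do rewrite muleC; exact: measurable_funeM.
have i10 (g : T -> \bar R) : (forall w, 0 <= g w)%E -> forall w, A w ->
    (0 <= (- X w')%:E * g w + (X w)%:E * g w')%E.
  move=> g0 w /= Xw; apply: adde_ge0; apply: mule_ge0 => //; rewrite lee_fin.
  - by move: Xw'; rewrite /B/=; lra.
  - exact: ltW.
apply: ge0_le_integral => //; [exact: i10|exact: mi1|exact: mi1|].
by move=> w /= Xw; exact: le_pn.
Qed.

(** By independence the joint law agrees with the product of the marginal laws on rectangles, hence
    everywhere, and Tonelli applies. Pulling each marginal back to [T] separately produces the
    independent copies. *)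
Lemma independent_integral (d : measure_display) (T : measurableType d)
    (R : realType) (P : probability T R) (X Y : {RV P >-> R})
    (h : R * R -> \bar R) :
  independent_RV X Y -> measurable_fun [set: R * R] h ->
  (forall z, 0 <= h z)%E ->
  (\int[P]_w h (X w, Y w) = \int[P]_w' \int[P]_w h (X w, Y w'))%E.
Proof.
move=> indep mh h0.
have mXY : measurable_fun [set: T] (fun w => (X w, Y w)).
  exact/measurable_fun_pair.
pose XY : {mfun T >-> (R * R)%type} := HB.pack (fun w => (X w, Y w))
  (isMeasurableFun.Build _ _ _ _ (fun w => (X w, Y w)) mXY).
transitivity (\int[pushforward P XY]_z h z)%E.
  by rewrite ge0_integral_pushforward.
rewrite (eq_measure_integral (distribution P X \x distribution P Y)%E); last first.
  move=> A mA _; apply/esym/product_measure_unique => // B C mB mC; exact: indep.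
rewrite fubini_tonelli2// ge0_integral_distribution//; last 2 first.
  exact: measurable_fun_fubini_tonelli_G.
  by move=> y; exact: integral_ge0.
apply: eq_integral => w' _ /=; rewrite /fubini_G ge0_integral_distribution//.
exact: measurableT_comp.
Qed.

(** [centered_integral_le] is used twice: with weight [Y] on the integrals over the values of [X],
    then with weight [X] on the integrands at two fixed values of [Y]. Its zero-weight condition
    holds because [F] vanishes on the axes. *)
Lemma independent_centered_integral_le (d : measure_display)
    (T : measurableType d) (R : realType) (P : probability T R)
    (X Y : {RV P >-> R}) (F : R -> R -> R) :
  independent_RV X Y ->
  P.-integrable [set: T] (EFin \o X) -> (\int[P]_w (X w)%:E = 0)%E ->
  P.-integrable [set: T] (EFin \o Y) -> (\int[P]_w (Y w)%:E = 0)%E ->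
  measurable_fun [set: R * R] (fun z => F z.1 z.2) ->
  (forall x, F x 0 = 0) -> (forall y, F 0 y = 0) ->
  (forall x x' y y', 0 < x -> x' < 0 -> 0 < y -> y' < 0 ->
    0 <= x' * y' * F x y + x * y * F x' y' - x' * y * F x y' - x * y' * F x' y) ->
  (\int[P]_w (Num.max (- F (X w) (Y w)) 0)%:E
    <= \int[P]_w (Num.max (F (X w) (Y w)) 0)%:E)%E.
Proof.
move=> indep iX X0 iY Y0 mF Fx0 F0y Fquad.
pose p (z : R * R) : \bar R := (Num.max (F z.1 z.2) 0)%:E.
pose q (z : R * R) : \bar R := (Num.max (- F z.1 z.2) 0)%:E.
have mp : measurable_fun [set: R * R] p.
  by apply/measurable_EFinP; exact: measurable_maxr.
have mq : measurable_fun [set: R * R] q.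
  by apply/measurable_EFinP; apply: measurable_maxr => //; exact: measurableT_comp.
have p0 z : (0 <= p z)%E by rewrite lee_fin le_max lexx orbT.
have q0 z : (0 <= q z)%E by rewrite lee_fin le_max lexx orbT.
have pqE x y : Num.max (F x y) 0 = Num.max (- F x y) 0 + F x y.
  by rewrite /Num.max; case: ifPn; case: ifPn; lra.
rewrite (independent_integral _ _ _ _ _ _ _ indep mq)//.
rewrite (independent_integral _ _ _ _ _ _ _ indep mp)//.
have mpair g : measurable_fun [set: R * R] g -> forall y,
    measurable_fun [set: T] (fun w => g (X w, y) : \bar R).
  move=> mg y; apply: (measurableT_comp mg); exact: measurable_fun_pair.
have mint g : measurable_fun [set: R * R] g -> (forall z, 0 <= g z)%E ->
    measurable_fun [set: T] (fun w' => \int[P]_w g (X w, Y w'))%E.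
  move=> mg g0.
  have := measurable_fun_fubini_tonelli_G (m1 := P) (fun z : T * R => g (X z.1, z.2)).
  move=> /(_ _ _)/measurableT_comp; apply => //.
  apply: (measurableT_comp mg); apply: measurable_fun_pair => //.
  exact: measurableT_comp.
apply: (centered_integral_le _ _ _ _ _ _ _ (mint _ mp p0) (mint _ mq q0) _ _ iY Y0).
- by move=> w'; exact: integral_ge0.
- by move=> w'; exact: integral_ge0.
- move=> w' ->; apply: ge0_le_integral => //; do ?exact: mpair.
  by move=> w _; rewrite lee_fin !Fx0 oppr0.
move=> v v' Yv Yv'.
have intD g : measurable_fun [set: R * R] g -> (forall z, 0 <= g z)%E ->
  ((- Y v')%:E * \int[P]_w g (X w, Y v) + (Y v)%:E * \int[P]_w g (X w, Y v') =
  \int[P]_w ((- Y v')%:E * g (X w, Y v) + (Y v)%:E * g (X w, Y v')))%E.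
  move=> mg g0; have mg' := mpair _ mg.
  have ? : (0 <= (- Y v')%:E)%E by rewrite lee_fin; lra.
  have ? : (0 <= (Y v)%:E)%E by rewrite lee_fin; lra.
  by rewrite ge0_integralD// ?ge0_integralZl//;
    do ?[by move=> w _; exact: mule_ge0|exact: measurable_funeM].
have comb0 (g : R * R -> \bar R) : (forall z, 0 <= g z)%E ->
    forall w, (0 <= (- Y v')%:E * g (X w, Y v) + (Y v)%:E * g (X w, Y v'))%E.
  by move=> g0 w; apply: adde_ge0; apply: mule_ge0 => //; rewrite lee_fin; lra.
have combm (g : R * R -> \bar R) : measurable_fun [set: R * R] g ->
    measurable_fun [set: T]
      (fun w => (- Y v')%:E * g (X w, Y v) + (Y v)%:E * g (X w, Y v'))%E.
  move=> mg; have mg' := mpair _ mg.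
  by apply: emeasurable_funD; exact: measurable_funeM.
rewrite !intD//.
apply: (centered_integral_le _ _ _ _ _ _ _ (combm _ mp) (combm _ mq) _ _ iX X0).
- exact: comb0.
- exact: comb0.
- by move=> w Xw; rewrite /p/q/= Xw !F0y oppr0.
move=> w w' Xw Xw'; rewrite /p /q /= -!(EFinM, EFinD) lee_fin.
(* Substituting [F^+ = F^- + F] cancels all the negative parts and leaves exactly [Fquad]. *)
rewrite !pqE; have := Fquad _ _ _ _ Xw Xw' Yv Yv'; lra.
Qed.

(** * Translations and primitives for the Lebesgue measure *)

Lemma measurable_shift (R : realType) (a : R) :
  measurable_fun [set: R] (fun t : R => a + t).
Proof. by apply: measurable_funD. Qed.

Lemma preimage_shift_itv (R : realType) (a x y : R) (b c : bool) :
  (fun t => a + t) @^-1` [set` Interval (BSide b (a + x)) (BSide c (a + y))] =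
  [set` Interval (BSide b x) (BSide c y)].
Proof.
by apply/seteqP; split=> t /=; rewrite !in_itv /=; case: b; case: c;
  rewrite /= ?lerD2l ?ltrD2l.
Qed.

Lemma lebesgue_measure_shift (R : realType) (a : R) (A : set R) : measurable A ->
  lebesgue_measure ((fun t => a + t) @^-1` A) = lebesgue_measure A.
Proof.
move=> mA.
pose s : {mfun measurableTypeR R >-> measurableTypeR R} := HB.pack
  (fun t : R => a + t)
  (isMeasurableFun.Build _ _ (measurableTypeR R) (measurableTypeR R)
    (fun t : R => a + t) (measurable_shift R a)).
apply/esym.
rewrite -[RHS]/(pushforward lebesgue_measure s A).
apply: lebesgue_measure_unique => //=.
move=> _ [[x y] /= xy <-]; rewrite /pushforward /=.
(* Uniqueness of the measure is tested on intervals []x, y]], whose two bounds both carry the flag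
   [false]. *)
have /= := preimage_shift_itv R a (x - a) (y - a) false false.
rewrite !subrKC => ->; rewrite !lebesgue_measure_itv /= !lte_fin ltrD2r.
by case: ifP => // _; rewrite -!EFinB; congr EFin; lra.
Qed.

Lemma ge0_integral_shift (R : realType) (a : R) (D : set R) (h : R -> \bar R) :
  measurable D -> measurable_fun D h -> (forall x, 0 <= h x)%E ->
  (\int[lebesgue_measure]_(t in (fun t => (a + t)%R) @^-1` D) h (a + t)%R
    = \int[lebesgue_measure]_(x in D) h x)%E.
Proof.
move=> mD mh h0.
pose s : {mfun measurableTypeR R >-> measurableTypeR R} := HB.pack
  (fun t : R => a + t)
  (isMeasurableFun.Build _ _ (measurableTypeR R) (measurableTypeR R)
    (fun t : R => a + t) (measurable_shift R a)).
transitivity (\int[pushforward lebesgue_measure s]_(x in D) h x)%E.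
  by rewrite (ge0_integral_pushforward (measurable_shift R a : measurable_fun
    (T := measurableTypeR R) (U := measurableTypeR R) _ _)).
by apply: eq_measure_integral => A mA _; exact: lebesgue_measure_shift.
Qed.

Lemma ae_shift (R : realType) (a : R) (Q : R -> Prop) :
  {ae @lebesgue_measure R, forall t, Q t} ->
  {ae @lebesgue_measure R, forall t, Q (a + t)}.
Proof.
move=> [N [mN N0 sN]]; exists ((fun t => a + t) @^-1` N); split.
- by rewrite -[X in measurable X]setTI; exact: measurable_shift.
- by rewrite -N0; exact: lebesgue_measure_shift.
- by move=> t /= nQ; exact: sN.
Qed.

Lemma ae_itv_exists (R : realType) (a b : R) (Q : R -> Prop) : a < b ->
  {ae @lebesgue_measure R, forall t, Q t} -> exists2 t, a < t < b & Q t.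
Proof.
move=> ab [N [mN N0 sN]]; apply: contrapT => nex.
have : lebesgue_measure (`]a, b[ : set R) = 0%E.
  apply: (subset_measure0 _ mN _ N0) => // t /=; rewrite in_itv/= => tab.
  by apply: sN => Qt; apply: nex; exists t.
by rewrite lebesgue_measure_itv/= lte_fin ab -EFinB => -[]; lra.
Qed.

(** The integral clause of [twice_differentiable] for an arbitrary pair, so that it passes to
    translates and differences of [f']. *)
Definition lebesgue_primitive (R : realType) (g phi : R -> R) : Prop :=
  forall a b, a < b ->
    (@lebesgue_measure R).-integrable `[a, b] (EFin \o g) /\
    (phi b - phi a)%:E = (\int[@lebesgue_measure R]_(t in `[a, b]) (g t)%:E)%E.

Lemma lebesgue_primitive_shift (R : realType) (a : R) (g phi : R -> R) :
  lebesgue_primitive R g phi ->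
  lebesgue_primitive R (fun t => g (a + t)) (fun t => phi (a + t)).
Proof.
move=> gphi x y xy; have [|/integrableP[mg ig] ->] := gphi (a + x) (a + y).
  by rewrite ltrD2l.
have S h : measurable_fun `[a + x, a + y] h -> (forall x, 0 <= h x)%E ->
   (\int[lebesgue_measure]_(t in `[x, y]) h (a + t)%R
    = \int[lebesgue_measure]_(t in `[(a + x)%R, (a + y)%R]) h t)%E.
  by move=> mh h0; rewrite -[RHS](ge0_integral_shift _ a)// preimage_shift_itv.
split.
  apply/integrableP; split.
    have := measurable_comp _ _ mg
      (measurable_funTS (measurable_shift R a) (D := `[x, y])).
    by apply => // _ /= [t + <-]; rewrite /= !in_itv/= !lerD2l.
  by rewrite (S (fun t => `|(g t)%:E|)%E)//; exact: measurableT_comp.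
pose sh := (fun t : R => a + t).
transitivity (\int[@lebesgue_measure R]_(t in `[x, y])
  ((EFin \o g) \o sh) t)%E => //.
(* The change of variable [S] is for nonnegative integrands, so positive and negative parts are
   shifted separately. *)
rewrite integralE [RHS]integralE (funepos_comp (EFin \o g) sh).
rewrite (funeneg_comp (EFin \o g) sh) -(S ((EFin \o g)^\+)%E)//; last first.
  exact: measurable_funepos.
by rewrite -(S ((EFin \o g)^\-)%E)//; exact: measurable_funeneg.
Qed.

Lemma lebesgue_primitiveB (R : realType) (g phi h psi : R -> R) :
  lebesgue_primitive R g phi -> lebesgue_primitive R h psi ->
  lebesgue_primitive R (g \- h) (phi \- psi).
Proof.
move=> gphi hpsi a b ab; have [ig Eg] := gphi a b ab; have [ih Eh] := hpsi a b ab.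
split.
  exact: (integrableB _ ig ih).
transitivity (\int[@lebesgue_measure R]_(t in `[a, b])
  ((EFin \o g) t - (EFin \o h) t))%E => //.
by rewrite (integralB _ ig ih)// -Eg -Eh -EFinB; congr EFin => /=; lra.
Qed.

Lemma lebesgue_primitive_ge (R : realType) (g phi : R -> R) (a b c : R) :
  lebesgue_primitive R g phi -> a < b ->
  {ae @lebesgue_measure R, forall t, a < t < b -> c <= g t} ->
  c * (b - a) <= phi b - phi a.
Proof.
move=> gphi ab [N [mN N0 sN]]; have [ig Eg] := gphi a b ab.
have mg : measurable_fun `[a, b] (EFin \o g) by exact: measurable_int ig.
have ig' : (@lebesgue_measure R).-integrable `]a, b[ (EFin \o g).
  by apply: integrableS ig => // t /=; rewrite !in_itv/= => /andP[/ltW-> /ltW->].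
have ic : (@lebesgue_measure R).-integrable `]a, b[ (EFin \o cst c).
  apply: integrableS (_ : (@lebesgue_measure R).-integrable `[a, b] _) => //.
    by move=> t /=; rewrite !in_itv/= => /andP[/ltW-> /ltW->].
  apply: continuous_compact_integrable => //; first exact: segment_compact.
  by move=> x; exact: cst_continuous.
(* Neither the endpoints nor the null set [N] affect the integrals; away from them [c <= g t] holds
   pointwise. *)
rewrite -lee_fin Eg integral_itv_bndoo; last exact: measurable_int ig'.
rewrite (negligible_integral mN _ ig')//.
have <- : (\int[lebesgue_measure]_(t in `]a, b[) (EFin \o cst c) t
    = (c * (b - a))%:E)%E.
  rewrite [LHS](integral_cst lebesgue_measure _ c%:E)//= lebesgue_measure_itv/=.
  by rewrite lte_fin ab EFinM EFinB.
rewrite (negligible_integral mN _ ic)//.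
apply: le_integral.
- exact: measurableD.
- by apply: integrableS ic => //; exact: measurableD.
- by apply: integrableS ig' => //; exact: measurableD.
move=> t; rewrite inE /= in_itv/= => -[tab nNt]; rewrite lee_fin.
by apply: contrapT => nle; apply: nNt; apply: sN => /(_ tab).
Qed.

(** * The mixed difference *)

(** The supremum of [g] over the negative points of [Q] is almost everywhere above [g] on the left
    of 0 and below [g] on the right, so it separates the two secant slopes of [phi] at 0. *)
Lemma secant_le (R : realType) (g phi : R -> R) (Q : R -> Prop) (y y' : R) :
  lebesgue_primitive R g phi -> {ae @lebesgue_measure R, forall t, Q t} ->
  (forall v v', 0 < v -> v' < 0 -> Q v -> Q v' -> g v' <= g v) ->
  0 < y -> y' < 0 ->
  y * (phi 0 - phi y') <= - y' * (phi y - phi 0).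
Proof.
move=> gphi aeQ gQ y0 y'0.
have aeF := ae_filter_ringOfSetsType (@lebesgue_measure R).
pose S := [set g v' | v' in [set v' | v' < 0 /\ Q v']].
(* Points of [Q] on both sides of 0 make [S] nonempty and bounded above, so that [sup S] is a true
   supremum and not a default value. *)
have [v /andP[v0 _] Qv] := ae_itv_exists R 0 1 Q ltr01 aeQ.
have [v' /andP[_ v'0] Qv'] := ae_itv_exists R (-1) 0 Q (ltrN10 R) aeQ.
have ubS t : 0 < t -> Q t -> ubound S (g t).
  by move=> t0 Qt _ [s [s0 Qs] <-]; exact: gQ.
have S0 : S !=set0 by exists (g v'); exists v'.
have hubS : has_ubound S by exists (g v); exact: ubS.
have right : sup S * (y - 0) <= phi y - phi 0.
  apply: (lebesgue_primitive_ge _ _ _ _ _ _ gphi y0); apply: filterS aeQ.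
  by move=> t Qt /andP[t0 _]; apply: ge_sup => //; exact: ubS.
(* The upper bound on the left is the lower bound for [- phi], a primitive of [- g], obtained as a
   difference with 0. *)
have zphi : lebesgue_primitive R (cst 0) (cst 0).
  move=> a b ab; split; first exact: integrable0.
  by rewrite subrr integral0.
have left : - sup S * (0 - y') <= (cst 0 \- phi) 0 - (cst 0 \- phi) y'.
  have Ngphi := lebesgue_primitiveB _ _ _ _ _ zphi gphi.
  apply: (lebesgue_primitive_ge _ _ _ _ _ _ Ngphi y'0).
  apply: filterS aeQ => t Qt /andP[_ t0] /=; rewrite sub0r lerN2.
  by apply: ub_le_sup => //; exists t.
rewrite /= in left; nra.
Qed.

Definition mixed_difference (R : realType) (f : R -> R) (x y : R) : R :=
  f (x + y) - f x - f y + f 0.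

(** The integration in [v] is done by [secant_le]. In the other direction the mean value theorem
    suffices, because the combination [Psi] of increments of [f] is differentiable everywhere. *)
Lemma mixed_difference_quad (R : realType) (f : R -> R) (E : R -> Prop)
    (x x' y y' : R) :
  (forall t, derivable f t 1) ->
  lebesgue_primitive R (second_derivative f) (derive1 f) ->
  {ae @lebesgue_measure R, forall t, E t} ->
  (forall u u' v v', 0 < u -> u' < 0 -> 0 < v -> v' < 0 ->
    E (u + v) -> E (u' + v) -> E (u + v') -> E (u' + v') ->
    second_derivative f (u + v') + second_derivative f (u' + v)
    <= second_derivative f (u' + v') + second_derivative f (u + v)) ->
  0 < x -> x' < 0 -> 0 < y -> y' < 0 ->
  0 <= x' * y' * mixed_difference R f x y + x * y * mixed_difference R f x' y'
       - x' * y * mixed_difference R f x y' - x * y' * mixed_difference R f x' y.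
Proof.
move=> df prim aeE ineq x0 x'0 y0 y'0.
have aeF := ae_filter_ringOfSetsType (@lebesgue_measure R).
(* [H] is the derivative of [Psi] below. Comparing [H u'] with [H u] amounts to [secant_le] for the
   difference of the translates of [f'] by [u] and [u']. *)
pose H t := - y' * (derive1 f (t + y) - derive1 f t)
  + y * (derive1 f (t + y') - derive1 f t).
have H_le u u' : 0 < u -> u' < 0 -> H u' <= H u.
  move=> u0 u'0.
  have := secant_le R _ _ (fun t => E (u + t) /\ E (u' + t)) y y'
    (lebesgue_primitiveB _ _ _ _ _ (lebesgue_primitive_shift _ u _ _ prim)
                                   (lebesgue_primitive_shift _ u' _ _ prim)).
  have : {ae @lebesgue_measure R, forall t, E (u + t) /\ E (u' + t)}.
    by apply: filterS2 (ae_shift _ u _ aeE) (ae_shift _ u' _ aeE) => t; split.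
  move=> /[swap] /[apply] /= /(_ _ y0 y'0).
  rewrite !addr0 => slope.
  have rearrange (p q p1 q1 p2 q2 : R) :
      y * (p - q - (p2 - q2)) <= - y' * (p1 - q1 - (p - q)) ->
      - y' * (q1 - q) + y * (q2 - q) <= - y' * (p1 - p) + y * (p2 - p) by nra.
  apply: rearrange; apply: slope => v v' v0 v'0 [E1 E2] [E3 E4].
  by rewrite lerBlDl addrA lerBrDr ineq.
pose Psi t := - y' * (f (t + y) - f t) + y * (f (t + y') - f t).
have df1 (t : R) : is_derive t 1 f (derive1 f t).
  by rewrite derive1E; exact: derivableP.
have dfs (a t : R) : is_derive t 1 (fun t => f (t + a)) (derive1 f (t + a)).
  have := @is_derive1_comp R f (shift a) t (derive1 f (t + a)) 1 (df1 _)
    (is_derive_shift _ _ _).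
  by rewrite mulr1.
have dPsi (t : R) : is_derive t 1 Psi (H t).
  rewrite /Psi /H; apply: is_deriveD.
have cPsi (i : interval R) : {within [set` i], continuous Psi}.
  by apply: derivable_within_continuous => t _; exact: ex_derive.
have [u uI Eu] := MVT x0 (fun t _ => dPsi t) (cPsi _).
have [u' u'I Eu'] := MVT x'0 (fun t _ => dPsi t) (cPsi _).
have Huu : H u' <= H u.
  by apply: H_le; [move: uI|move: u'I]; rewrite in_itv/= => /andP[].
(* With [F] the mixed difference, [Psi x - Psi 0] equals [- y' F x y + y F x y'], and likewise at
   [x']. *)
have -> : x' * y' * mixed_difference R f x y + x * y * mixed_difference R f x' y'
    - x' * y * mixed_difference R f x y' - x * y' * mixed_difference R f x' y
    = - x' * (Psi x - Psi 0) - x * (Psi 0 - Psi x').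
  by rewrite /Psi /mixed_difference !add0r; ring.
rewrite Eu Eu'; move: (H u) (H u') Huu => h h' hh.
have -> : - x' * (h * (x - 0)) - x * (h' * (0 - x')) = - x' * x * (h - h') by ring.
by rewrite !mulr_ge0 ?subr_ge0// ?oppr_ge0 ltW.
Qed.

(** * The theorem *)

Lemma ge0_integrable (d : measure_display) (T : measurableType d) (R : realType)
    (mu : {measure set T -> \bar R}) (X : T -> R) :
  measurable_fun [set: T] X -> (forall w, 0 <= X w) ->
  (\int[mu]_w (X w)%:E < +oo)%E -> mu.-integrable [set: T] (EFin \o X).
Proof.
move=> mX X0 Xoo; apply/integrableP; split; first exact/measurable_EFinP.
by under eq_integral do rewrite /= ger0_norm//.
Qed.

Lemma integral_maxrE (d : measure_display) (T : measurableType d)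
    (R : realType) (mu : {measure set T -> \bar R}) (X : T -> R) :
  (\int[mu]_w (X w)%:E =
    \int[mu]_w (Num.max (X w) 0)%:E - \int[mu]_w (Num.max (- X w) 0)%:E)%E.
Proof.
rewrite integralE; congr (_ - _)%E; apply: eq_integral => w _.
  by rewrite funeposE EFin_max.
by rewrite funenegE EFin_max.
Qed.

Lemma ler_norm_maxr (R : realDomainType) (r : R) :
  `|r| <= Num.max r 0 + Num.max (- r) 0.
Proof. by rewrite ler_norml /Num.max; case: ifPn; case: ifPn; lra. Qed.

(** With [a], [b], [s] standing for [f] at [xi], [eta] and their sum, [M] gathers the one-sided
    parts that have finite mean in the last case of the theorem. The first bound serves to make [F]
    integrable, the other two then transfer this to [f(xi)] and [f(eta)]. *)
Lemma mixed_difference_bounds (R : realDomainType) (a b s c : R) :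
  let M := Num.max (- a) 0 + Num.max (- b) 0 + (Num.max s 0 + `|c|) in
  let F := s - a - b + c in
  [/\ Num.max F 0 <= M, `|a| <= M + `|F| & `|b| <= M + `|F| ].
Proof.
move=> M F; have maxl (r : R) : r <= Num.max r 0 by rewrite le_max lexx.
have maxr (r : R) : 0 <= Num.max r 0 by rewrite le_max lexx orbT.
have := maxl (- a); have := maxr (- a); have := maxl (- b); have := maxr (- b).
have := maxl s; have := maxr s; have := ler_norm c; have := normr_ge0 c.
have := ler_norm (- F); have := normr_ge0 F; rewrite normrN.
rewrite ge_max !ler_norml /M; move: `|F| `|c| (Num.max (- a) 0) => F' c' a'.
move: (Num.max (- b) 0) (Num.max s 0) => b' s'; rewrite /F => *.
by split; [apply/andP; split|apply/andP; split|apply/andP; split]; lra.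
Qed.

Theorem theorem2 (R : realType) (f : R -> R)
    (f_diff : twice_differentiable f)
    (f0 : f 0 <= 0)
    (f_ineq : forall alpha beta gamma : R,
      0 < alpha -> 0 < beta -> 0 < gamma -> gamma < alpha + beta ->
      has_second_derivative f (- alpha) ->
      has_second_derivative f beta ->
      has_second_derivative f (- alpha + gamma) ->
      has_second_derivative f (beta - gamma) ->
      second_derivative f (- alpha) + second_derivative f beta
        >= second_derivative f (- alpha + gamma)
           + second_derivative f (beta - gamma))
    (d : measure_display) (T : measurableType d) (P : probability T R)
    (xi eta : {RV P >-> R})
    (xi_centered : centered xi) (eta_centered : centered eta)
    (indep : independent_RV xi eta)
    (E_xi : expectation_exists P (fun w => f (xi w)))
    (E_eta : expectation_exists P (fun w => f (eta w)))
    (E_sum : expectation_exists P (fun w => f (xi w + eta w))) :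
  ('E_P[fun w => f (xi w)] + 'E_P[fun w => f (eta w)]
    <= 'E_P[fun w => f (xi w + eta w)%R])%E.
Proof.
have [df aeE prim] := f_diff.
have mf : measurable_fun [set: R] f.
  apply: continuous_measurable_fun => x.
  by apply: differentiable_continuous; apply/derivable1_diffP.
have g_ineq u u' v v' : 0 < u -> u' < 0 -> 0 < v -> v' < 0 ->
    has_second_derivative f (u + v) -> has_second_derivative f (u' + v) ->
    has_second_derivative f (u + v') -> has_second_derivative f (u' + v') ->
    second_derivative f (u + v') + second_derivative f (u' + v)
    <= second_derivative f (u' + v') + second_derivative f (u + v).
  move=> u0 u'0 v0 v'0 E1 E2 E3 E4.
  (* With [alpha = - (u' + v')], [beta = u + v] and [gamma = u - u'], the two inner points
     [- alpha + gamma] and [beta - gamma] are [u + v'] and [u' + v]. *)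
  have alpha0 : 0 < - (u' + v') by rewrite oppr_gt0 ltr_nwDl// ltW.
  have gamma0 : 0 < u - u' by rewrite subr_gt0 (lt_trans u'0).
  have gamma_lt : u - u' < - (u' + v') + (u + v).
    have -> : - (u' + v') + (u + v) = (u - u') + (v - v') by ring.
    by rewrite ltrDl subr_gt0 (lt_trans v'0).
  have := f_ineq _ _ _ alpha0 (addr_gt0 u0 v0) gamma0 gamma_lt.
  have -> : - - (u' + v') + (u - u') = u + v' by ring.
  have -> : u + v - (u - u') = u' + v by ring.
  by rewrite (opprK (u' + v')) => /(_ E4 E1 E3 E2).
have prim' : lebesgue_primitive R (second_derivative f) (derive1 f).
  by move=> a b ab; exact: prim.
have centeredP (X : {RV P >-> R}) : centered X ->
    P.-integrable [set: T] (EFin \o X) /\ (\int[P]_w (X w)%:E = 0)%E.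
  rewrite /centered unlock => -[X1 X0]; split => //.
  by apply/integrableP; split => //; exact/measurable_EFinP.
have [ixi xi0] := centeredP _ xi_centered.
have [ieta eta0] := centeredP _ eta_centered.
have F_le : (\int[P]_w (Num.max (- mixed_difference R f (xi w) (eta w)) 0)%:E
    <= \int[P]_w (Num.max (mixed_difference R f (xi w) (eta w)) 0)%:E)%E.
  apply: (independent_centered_integral_le _ _ _ _ _ _ _ indep ixi xi0 ieta eta0).
  - apply: measurable_funD => //; apply: measurable_funB.
      apply: measurable_funB; last exact: measurableT_comp.
      by apply: measurableT_comp => //; exact: measurable_funD.
    exact: measurableT_comp.
  - by move=> x; rewrite /mixed_difference addr0; ring.
  - by move=> x; rewrite /mixed_difference add0r; ring.
  - move=> x x' y y'.
    exact: (mixed_difference_quad _ _ _ _ _ _ _ df prim' aeE g_ineq).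
rewrite unlock.
have m_xi : measurable_fun [set: T] (f \o xi) by exact: measurableT_comp.
have m_eta : measurable_fun [set: T] (f \o eta) by exact: measurableT_comp.
have m_sum : measurable_fun [set: T] (fun w => f (xi w + eta w)).
  by apply: measurableT_comp => //; exact: measurable_funD.
pose F w := mixed_difference R f (xi w) (eta w).
have mF : measurable_fun [set: T] F.
  by apply: measurable_funD => //; do 2 apply: measurable_funB => //.
have mpos (X : T -> R) : measurable_fun [set: T] X ->
    measurable_fun [set: T] (fun w => Num.max (X w) 0).
  by move=> mX; exact: measurable_maxr.
have mneg (X : T -> R) : measurable_fun [set: T] X ->
    measurable_fun [set: T] (fun w => Num.max (- X w) 0).
  by move=> mX; apply: measurable_maxr => //; exact: measurableT_comp.
have max0 (r : R) : 0 <= Num.max r 0 by rewrite le_max lexx orbT.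
(* In extended addition [-oo] absorbs even [+oo], so an infinite negative part of [f(xi)] or
   [f(eta)] makes the left-hand side [-oo]. *)
have [xi_oo|xi_fin] := eqVneq (\int[P]_w (Num.max (- f (xi w)) 0)%:E)%E +oo%E.
  by rewrite [X in (X + _)%E]integral_maxrE xi_oo addeNy addNye leNye.
have [eta_oo|eta_fin] := eqVneq (\int[P]_w (Num.max (- f (eta w)) 0)%:E)%E +oo%E.
  by rewrite [X in (_ + X)%E]integral_maxrE eta_oo !addeNy leNye.
(* Here existence of the expectation forces the negative part to have finite mean, so the right-hand
   side is [+oo]. *)
have [s_oo|s_fin] := eqVneq (\int[P]_w (Num.max (f (xi w + eta w)) 0)%:E)%E +oo%E.
  rewrite [leRHS]integral_maxrE s_oo; case: E_sum; rewrite unlock.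
    by rewrite /funrpos s_oo ltxx.
  rewrite /funrneg => s_lt; rewrite addye ?leey//.
  by rewrite eqe_oppLR /= -ltey.
have i_xi : P.-integrable [set: T] (EFin \o (fun w => Num.max (- f (xi w)) 0)).
  by apply: ge0_integrable => //; [exact: (mneg (f \o xi))|rewrite ltey].
have i_eta : P.-integrable [set: T] (EFin \o (fun w => Num.max (- f (eta w)) 0)).
  by apply: ge0_integrable => //; [exact: (mneg (f \o eta))|rewrite ltey].
have i_sum : P.-integrable [set: T] (EFin \o (fun w => Num.max (f (xi w + eta w)) 0)).
  by apply: ge0_integrable => //; [exact: mpos|rewrite ltey].
have i_cst : P.-integrable [set: T] (EFin \o (fun w => `|f 0|)).
  exact: finite_measure_integrable_cst.
have iD (X Y : T -> R) : P.-integrable [set: T] (EFin \o X) ->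
    P.-integrable [set: T] (EFin \o Y) ->
    P.-integrable [set: T] (EFin \o (fun w => X w + Y w)).
  by move=> iX iY; exact: (integrableD _ iX iY).
have ile (X Y : T -> R) : measurable_fun [set: T] X ->
    (forall w, `|X w| <= Y w) -> P.-integrable [set: T] (EFin \o Y) ->
    P.-integrable [set: T] (EFin \o X).
  move=> mX XY; apply: le_integrable => //; first exact/measurable_EFinP.
  by move=> w _; rewrite /= lee_fin (le_trans (XY w))// ler_norm.
have bounds w := mixed_difference_bounds R (f (xi w)) (f (eta w))
  (f (xi w + eta w)) (f 0).
have i_bound := iD _ _ (iD _ _ i_xi i_eta) (iD _ _ i_sum i_cst).
(* The positive part of [F] is dominated by an integrable function, and [F_le] carries the finite
   mean over to the negative part. *)
have i_Fpos : P.-integrable [set: T] (EFin \o (fun w => Num.max (F w) 0)).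
  apply: (ile _ _ _ _ i_bound); first exact: mpos.
  by move=> w; rewrite ger0_norm//; have [] := bounds w.
have i_Fneg : P.-integrable [set: T] (EFin \o (fun w => Num.max (- F w) 0)).
  apply: ge0_integrable => //; first exact: mneg.
  apply: (le_lt_trans F_le); rewrite ltey_eq.
  by rewrite (integrable_fin_num _ i_Fpos).
have i_Fsum := iD _ _ i_Fpos i_Fneg.
have F_norm w : `|F w| <= Num.max (F w) 0 + Num.max (- F w) 0.
  exact: ler_norm_maxr.
have i_F : P.-integrable [set: T] (EFin \o F) by exact: (ile _ _ mF _ i_Fsum).
have F_ge0 : (0 <= \int[P]_w (F w)%:E)%E.
  rewrite integral_maxrE sube_ge0 ?F_le// (integrable_fin_num _ i_Fneg)//.
have i_abs : P.-integrable [set: T] (EFin \o (fun w => `|F w|)).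
  by apply: (ile _ _ _ _ i_Fsum) => [|w]; [exact: measurableT_comp|rewrite normr_id].
have ifxi : P.-integrable [set: T] (EFin \o (f \o xi)).
  by apply: (ile _ _ m_xi _ (iD _ _ i_bound i_abs)) => w; have [] := bounds w.
have ifeta : P.-integrable [set: T] (EFin \o (f \o eta)).
  by apply: (ile _ _ m_eta _ (iD _ _ i_bound i_abs)) => w; have [] := bounds w.
have intD (X Y : T -> R) : P.-integrable [set: T] (EFin \o X) ->
    P.-integrable [set: T] (EFin \o Y) ->
    (\int[P]_w (X w + Y w)%:E = \int[P]_w (X w)%:E + \int[P]_w (Y w)%:E)%E.
  by move=> iX iY; exact: (integralD _ iX iY).
have i_f0 : P.-integrable [set: T] (EFin \o cst (- f 0)).
  exact: finite_measure_integrable_cst.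
(* The excess of the right-hand side is the mean of [F - f 0], nonnegative by [F_ge0] and
   [f 0 <= 0]. *)
have -> : (\int[P]_w (f (xi w + eta w))%:E =
    \int[P]_w (f (xi w) + f (eta w))%:E + \int[P]_w (F w - f 0)%:E)%E.
  rewrite -(intD _ _ (iD _ _ ifxi ifeta) (iD _ _ i_F i_f0)).
  by apply: eq_integral => w _; congr EFin; rewrite /F /mixed_difference/=; ring.
rewrite (intD _ _ ifxi ifeta) leeDl// (intD _ _ i_F i_f0) adde_ge0//.
by apply: integral_ge0 => w _; rewrite lee_fin oppr_ge0.
Qed.
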